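(* Let $A$ be a normed algebra over $\mathbb{C}$ (not necessarily associative, unital or complete) which is a left linear division algebra, and suppose that the set $D_g(A)$ of left linear topological divisors of zero of $A$ is a complete subset of $A$ (for the metric induced by the norm). Then $A$ is isomorphic, as a $\mathbb{C}$-algebra, to $\mathbb{C}$.
   Context: An algebra over a field $K$ is a $K$-vector space $A$ with a $K$-bilinear product; no associativity, commutativity or unit is assumed. For $x\in A$, $L_x:A\to A$ is $y\mapsto xy$. A $\mathbb{C}$-algebra $A$ is normed if the vector space $A$ carries a norm with $\|xy\|\le\|x\|\,\|y\|$ for all $x,y$. $A$ is a left linear division algebra if $A\neq\{0\}$ and $L_x$ is bijective for every nonzero $x\in A$. An element $a\in A$ is a left linear topological divisor of zero if there is a sequence $(x_n)$ in $A$ with $\|x_n\|=1$ for all $n$ and $ax_n\to 0$; $D_g(A)$ denotes the set of all such elements. *)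

(* Defs.v *)
From mathcomp Require Import all_boot all_order all_algebra.
From mathcomp Require Import all_classical all_reals all_analysis.
From mathcomp Require Import complex.

Set Implicit Arguments.
Unset Strict Implicit.
Unset Printing Implicit Defensive.

Import Order.TTheory GRing.Theory Num.Theory.
Import numFieldNormedType.Exports.

Local Open Scope classical_set_scope.
Local Open Scope ring_scope.

(* A (nonassociative, nonunital) K-algebra is a K-module A together with a
   product mul : {bilinear A -> A -> A}; L_x is [mul x]. When K is R[i], the
   norm of A takes its values in R[i], in the nonnegative reals. *)

Definition submultiplicative (K : numFieldType) (A : normedModType K)
    (mul : {bilinear A -> A -> A}) : Prop :=
  forall x y : A, `|mul x y| <= `|x| * `|y|.

Definition left_linear_division (K : nzRingType) (A : lmodType K)
    (mul : {bilinear A -> A -> A}) : Prop :=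
  (exists x : A, x != 0) /\ forall x : A, x != 0 -> bijective (mul x).

Definition left_topological_zero_divisors (K : numFieldType)
    (A : normedModType K) (mul : {bilinear A -> A -> A}) : set A :=
  [set a | exists x : nat -> A,
     (forall n, `|x n| = 1) /\ mul a (x n) @[n --> \oo] --> (0 : A)].

(* The library only has completeness of a whole uniform space. *)
Definition complete_subset (K : numFieldType) (A : normedModType K)
    (D : set A) : Prop :=
  forall u : nat -> A, (forall n, D (u n)) -> cauchy (u @ \oo) ->
    exists2 l : A, D l & u @ \oo --> l.

Definition algebra_isomorphic (K : nzRingType) (A B : lmodType K)
    (mulA : A -> A -> A) (mulB : B -> B -> B) : Prop :=
  exists f : {linear A -> B},
    bijective f /\ forall x y : A, f (mulA x y) = mulB (f x) (f y).

(* Main.v *)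
(* If b is not a left topological divisor of zero, then for every c the operator
   T = L_b^-1 L_c is bounded and T - l is bijective unless c = l b. A bounded
   operator on a normed space, complete or not, has some l such that T - l is
   not bounded below, so c - l b lies in D_g with l bounded in terms of c: hence
   A = D_g + C b. Completeness of D_g and compactness of bounded sets of scalars
   then make A complete, which also holds if D_g = A. By the open mapping
   theorem no nonzero L_a of the Banach space A fails to be bounded below, so
   D_g = {0} and A = C b. *)

Require Import Defs.
From HB Require Import structures.
From mathcomp Require Import all_boot all_order all_algebra.
From mathcomp Require Import all_classical all_reals all_analysis.
From mathcomp Require Import complex.
From mathcomp Require Import ring lra.

Set Implicit Arguments.
Unset Strict Implicit.
Unset Printing Implicit Defensive.

Import Order.TTheory GRing.Theory Num.Theory.
Import numFieldNormedType.Exports.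

Local Open Scope classical_set_scope.
Local Open Scope ring_scope.

(** * Real-valued norms over the complex numbers *)

(* [`|x|] lives in the partially ordered field R[i]; its real part carries the
   same information in the totally ordered field R. *)
Definition rnorm (R : realType) (V : normedZmodType R[i]) (x : V) : R :=
  complex.Re `|x|.

Lemma rnormE (R : realType) (V : normedZmodType R[i]) (x : V) :
  `|x| = (rnorm x)%:C%C.
Proof. by rewrite /rnorm RRe_real // normr_real. Qed.

Lemma rnorm_ge0 (R : realType) (V : normedZmodType R[i]) (x : V) :
  0 <= rnorm x.
Proof. by rewrite -ler0c -rnormE. Qed.

Lemma rnorm_eq0 (R : realType) (V : normedZmodType R[i]) (x : V) :
  (rnorm x == 0) = (x == 0).
Proof. by rewrite -(inj_eq (@complexI R)) -rnormE normr_eq0. Qed.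

Lemma rnorm0 (R : realType) (V : normedZmodType R[i]) : rnorm (0 : V) = 0.
Proof. by apply/eqP; rewrite rnorm_eq0. Qed.

Lemma rnorm_gt0 (R : realType) (V : normedZmodType R[i]) (x : V) :
  (0 < rnorm x) = (x != 0).
Proof. by rewrite lt_def rnorm_eq0 rnorm_ge0 andbT. Qed.

Lemma rnormD (R : realType) (V : normedZmodType R[i]) (x y : V) :
  rnorm (x + y) <= rnorm x + rnorm y.
Proof. by rewrite -lecR rmorphD /= -!rnormE ler_normD. Qed.

Lemma rnormN (R : realType) (V : normedZmodType R[i]) (x : V) :
  rnorm (- x) = rnorm x.
Proof. by rewrite /rnorm normrN. Qed.

Lemma rnormB (R : realType) (V : normedZmodType R[i]) (x y : V) :
  rnorm (x - y) <= rnorm x + rnorm y.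
Proof. by rewrite -(rnormN y) rnormD. Qed.

Lemma rdistC (R : realType) (V : normedZmodType R[i]) (x y : V) :
  rnorm (x - y) = rnorm (y - x).
Proof. by rewrite -rnormN opprB. Qed.

Lemma rnormZ (R : realType) (V : normedModType R[i]) (a : R[i]) (x : V) :
  rnorm (a *: x) = rnorm a * rnorm x.
Proof. by apply: complexI; rewrite rmorphM /= -!rnormE normrZ. Qed.

Lemma rnormM (R : realType) (a b : R[i]) : rnorm (a * b) = rnorm a * rnorm b.
Proof. by apply: complexI; rewrite rmorphM /= -!rnormE normrM. Qed.

Lemma rnormX (R : realType) (a : R[i]) n : rnorm (a ^+ n) = rnorm a ^+ n.
Proof. by apply: complexI; rewrite rmorphXn /= -!rnormE normrX. Qed.

Lemma rnormC (R : realType) (r : R) : 0 <= r -> rnorm (r%:C%C : R[i]) = r.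
Proof. by move=> r0; apply: complexI; rewrite -rnormE ger0_norm // ler0c. Qed.

Lemma rnorm1 (R : realType) : rnorm (1 : R[i]) = 1.
Proof. by rewrite /rnorm normr1. Qed.

Lemma triangle (R : realType) (V : normedZmodType R[i]) (y x z : V) :
  rnorm (x - z) <= rnorm (x - y) + rnorm (y - z).
Proof. by rewrite -{1}(subrK y x) -addrA rnormD. Qed.

(** * Powers T^n - l^n with n = 2^j, and the resolvent of a bounded operator *)

Lemma linear_iter (K : pzRingType) (V : lmodType K) (T : {linear V -> V}) n :
  linear (iter n T).
Proof. by elim: n => [|n IH] a u v //=; rewrite IH linearP. Qed.

Lemma iter2X (V : Type) (T : V -> V) j v :
  iter (2 ^ j.+1) T v = iter (2 ^ j) T (iter (2 ^ j) T v).
Proof. by rewrite expnS mul2n -addnn iterD. Qed.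

Lemma iterB (K : pzRingType) (V : lmodType K) (T : {linear V -> V}) n a u v :
  iter n T (u - a *: v) = iter n T u - a *: iter n T v.
Proof.
have /= := linear_iter T n (- a) v u.
by rewrite [u - _]addrC [RHS]addrC !scaleNr.
Qed.

(** With n = 2^j, replacing [l] by [z * l] changes T^n - l^n into T^n + l^n, and these are the two
    factors of T^(2n) - l^(2n). Modulus one keeps distances between scalars unchanged. Both
    inductions on [j] below rest on this. *)
Lemma unit_root_N1 (R : realType) j :
  exists2 z : R[i], rnorm z = 1 & z ^+ (2 ^ j) = -1.
Proof.
have n0 : (0 < 2 ^ j)%N by rewrite expn_gt0.
have zn : (2 ^ j).-root (-1 : R[i]) ^+ (2 ^ j) = -1 by rewrite rootCK.
exists ((2 ^ j).-root (-1)) => //; apply/eqP.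
rewrite -(@pexpr_eq1 _ _ (2 ^ j)) ?rnorm_ge0 -?lt0n // -rnormX zn.
by rewrite rnormN rnorm1.
Qed.

Lemma iter_sub_expr_surj (R : realType) (V : lmodType R[i])
    (T : {linear V -> V}) :
  (forall (l : R[i]) x, exists v, T v - l *: v = x) ->
  forall j (l : R[i]) x,
    exists v, iter (2 ^ j) T v - l ^+ (2 ^ j) *: v = x.
Proof.
move=> Ts; elim=> [|j IH] l x; first by have [v vx] := Ts l x; exists v.
have [z _ zn] := unit_root_N1 R j.
have [w <-] := IH (z * l) x; have [v <-] := IH l w; exists v.
rewrite iterB iter2X exprMn zn mulN1r scaleNr opprK scalerBr addrA subrK.
by rewrite scalerA -exprD addnn -mul2n -expnS.
Qed.

(* With n = 2^j, T^n (T^n - l^n)^-1 is the average over the n-th roots of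
   unity z of T (T - z l)^-1; the induction on j below hides this average. *)
Lemma iter_resolvent_lipschitz (R : realType) (V : normedModType R[i])
    (T : {linear V -> V}) (m C d : R) : 0 < m -> 0 <= C ->
  (forall x, rnorm (T x) <= C * rnorm x) ->
  (forall (l : R[i]) x, m * rnorm x <= rnorm (T x - l *: x)) ->
  forall j (a b : R[i]) u v x, rnorm (a - b) <= d ->
    iter (2 ^ j) T u - a ^+ (2 ^ j) *: u = x ->
    iter (2 ^ j) T v - b ^+ (2 ^ j) *: v = x ->
    m ^+ 2 * rnorm (iter (2 ^ j) T u - iter (2 ^ j) T v) <= C * d * rnorm x.
Proof.
move=> m0 C0 Tb Tm; elim=> [|j IH] a b u v x abd.
  rewrite expn0 !expr1 /= -linearB => ux vx.
  (* This is the resolvent identity: u - v = (a - b) (T - a)^-1 (T - b)^-1 x. The two inverses cost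
     the factor [m ^+ 2]. *)
  have E : T (u - v) - a *: (u - v) = (a - b) *: v.
    have -> : T (u - v) = a *: u - b *: v.
      rewrite linearB -[T u](subrK (a *: u)) ux -[T v](subrK (b *: v)) vx.
      by rewrite [LHS]addrC opprD addrACA addNr add0r addrC.
    by rewrite scalerBr scalerBl opprB addrC addrA subrK.
  have h1 := Tm a (u - v); rewrite E rnormZ in h1.
  have h2 := Tm b v; rewrite vx in h2.
  have h3 := Tb (u - v).
  have h4 : m * (m * rnorm (u - v)) <= d * rnorm x.
    apply: (le_trans (ler_wpM2l (ltW m0) h1)).
    rewrite mulrCA; apply: ler_pM => //; rewrite ?rnorm_ge0 //.
    by rewrite mulr_ge0 ?rnorm_ge0 ?ltW.
  rewrite expr2 -!mulrA.
  apply: (@le_trans _ _ (C * (m * (m * rnorm (u - v))))).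
    rewrite mulrCA [leRHS]mulrCA ler_wpM2l ?(ltW m0) //.
    by rewrite mulrCA ler_wpM2l ?(ltW m0).
  by rewrite ler_wpM2l.
move=> ux vx; have [z z1 zn] := unit_root_N1 R j.
set n := (2 ^ j)%N in IH zn *.
(* Partial fractions: 2 T^(2n) (T^(2n) - c^(2n))^-1 = T^n (T^n - c^n)^-1 + T^n (T^n + c^n)^-1. The
   left side is thus an average of two terms covered by the induction hypothesis, so the Lipschitz
   constant does not grow with [j]. *)
have key (c : R[i]) w : iter (2 ^ j.+1) T w - c ^+ (2 ^ j.+1) *: w = x ->
    let w1 := iter n T w - (z * c) ^+ n *: w in
    let w2 := iter n T w - c ^+ n *: w in
    [/\ iter n T w1 - c ^+ n *: w1 = x,
        iter n T w2 - (z * c) ^+ n *: w2 = x &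
        iter n T w1 + iter n T w2 = 2 *: iter (2 ^ j.+1) T w].
  move=> <- /=; rewrite !iterB iter2X -/n exprMn zn mulN1r !scaleNr !opprK.
  have -> : c ^+ (2 ^ j.+1) = c ^+ n * c ^+ n.
    by rewrite -exprD addnn -mul2n -expnS.
  rewrite -!scalerA; split.
  - by rewrite scalerDr opprD addrA addrK.
  - by rewrite scalerBr addrA subrK.
  - by rewrite addrACA subrr addr0 -mulr2n scaler_nat.
have [u1 u2 u3] := key _ _ ux; have [v1 v2 v3] := key _ _ vx.
have h1 := IH _ _ _ _ _ abd u1 v1.
have zd : rnorm (z * a - z * b) <= d by rewrite -mulrBr rnormM z1 mul1r.
have h2 := IH _ _ _ _ _ zd u2 v2.
have h3 := rnormD (iter n T (iter n T u - (z * a) ^+ n *: u)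
   - iter n T (iter n T v - (z * b) ^+ n *: v))
  (iter n T (iter n T u - a ^+ n *: u) - iter n T (iter n T v - b ^+ n *: v)).
rewrite addrACA -opprD u3 v3 -scalerBr rnormZ in h3.
have r2 : rnorm (2 : R[i]) = 2 by rewrite -(rnormC (ler0n R 2)) rmorph_nat.
rewrite r2 in h3.
have := ler_wpM2l (sqr_ge0 m) h3; rewrite mulrCA mulrDr => h4.
lra.
Qed.

Lemma expr_pow2_small (R : realType) (q : R) : 0 <= q < 1 ->
  exists j0, forall j, (j0 <= j)%N -> 4 * q ^+ (2 ^ j) <= 1.
Proof.
move=> /andP[q0 q1].
have /cvg_expr/cvgrPdist_lt/(_ (4^-1)) : `|q| < 1 by rewrite ger0_norm.
case; first by rewrite invr_gt0.
move=> j0 _ h; exists j0 => j jj.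
have /= := h j jj; rewrite sub0r normrN ger0_norm ?exprn_ge0 // => hj.
have : q ^+ (2 ^ j) <= q ^+ j.
  apply: ler_wiXn2l; rewrite ?q0 ?ltW //.
  exact/ltnW/ltn_expl.
lra.
Qed.

Lemma rnorm_iter (R : realType) (V : normedModType R[i]) (T : V -> V) (C : R) :
  0 <= C -> (forall x, rnorm (T x) <= C * rnorm x) ->
  forall n x, rnorm (iter n T x) <= C ^+ n * rnorm x.
Proof.
move=> C0 Tb; elim=> [|n IH] x; first by rewrite expr0 mul1r.
by rewrite iterS exprS -mulrA (le_trans (Tb _)) // ler_wpM2l.
Qed.

(* If all T - l were bounded below by m, then the smallness of r^n |T^-n| for
   large n = 2^j would persist when r is increased by a step depending only on
   m and C, hence hold for arbitrarily large r, contradicting |T^n| <= C^n. *)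
Lemma resolvent_unbounded (R : realType) (V : normedModType R[i])
    (T : {linear V -> V}) (C m : R) (w0 : V) : w0 != 0 -> 0 < m ->
  (forall x, rnorm (T x) <= C * rnorm x) ->
  (forall (l : R[i]) x, exists v, T v - l *: v = x) ->
  exists (l : R[i]) x, rnorm (T x - l *: x) < m * rnorm x.
Proof.
move=> w00 m0 Tb Ts; apply: contrapT => hn.
have {hn} Tm (l : R[i]) x : m * rnorm x <= rnorm (T x - l *: x).
  by rewrite leNgt; apply/negP => h; apply: hn; exists l, x.
have w0p : 0 < rnorm w0 by rewrite rnorm_gt0.
have C0 : 0 <= C by rewrite -(pmulr_lge0 _ w0p) (le_trans (rnorm_ge0 (T w0))).
(* In operator terms, r^n |T^-n| <= 1/4 for all large n = 2^j. The factor 4 is the slack that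
   absorbs the change of scalar in [step]. *)
pose Q (r : R) := exists j0, forall j, (j0 <= j)%N -> forall w,
  4 * (r ^+ (2 ^ j) * rnorm w) <= rnorm (iter (2 ^ j) T w).
(* Chosen so that moving the scalar by 2h changes T^n (T^n - l^n)^-1 by at most 2hC / m^2 <= 1/6;
   [C + 1] keeps the denominator positive. *)
pose h := m ^+ 2 / (12 * (C + 1)).
have h0 : 0 < h by rewrite divr_gt0 ?exprn_gt0 // mulr_gt0 // ltr_wpDl.
have step r : 0 <= r -> Q r -> Q (r + h).
  move=> r0 [j0 hj0].
  (* Overshooting by twice the step: at r' only the constant 1 is obtained, and ((r + h) / r')^n <=
     1/4 for large n restores the factor 4 at r + h. *)
  pose r' := r + 2 * h.
  have r'0 : 0 < r' by rewrite ltr_wpDl // mulr_gt0.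
  have [|j1 hj1] := @expr_pow2_small _ ((r + h) / r').
    apply/andP; split.
      by apply: divr_ge0; [apply: addr_ge0 => //|]; exact: ltW.
    by rewrite ltr_pdivrMr // mul1r /r' ltrD2l mulrDl mul1r ltrDl.
  exists (maxn j0 j1) => j; rewrite geq_max => /andP[jj0 jj1] w.
  set n := (2 ^ j)%N.
  pose a : R[i] := r%:C%C; pose b : R[i] := r'%:C%C.
  set x := iter n T w - b ^+ n *: w.
  (* [u] and [w] have the same image [x] under T^n - a^n and T^n - b^n respectively, so the
     Lipschitz estimate compares them. *)
  have [u ux] := iter_sub_expr_surj Ts j a x.
  have ab : rnorm (a - b) <= 2 * h.
    by rewrite rdistC -rmorphB rnormC /r' addrAC subrr add0r // mulr_ge0 // ltW.
  have := iter_resolvent_lipschitz m0 C0 Tb Tm ab ux (erefl x).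
  rewrite -/n => D; have {D} D : 6 * rnorm (iter n T u - iter n T w) <= rnorm x.
    have m20 : 0 < m ^+ 2 by rewrite exprn_gt0.
    rewrite -(ler_pM2l m20) mulrCA.
    have Ch : C * (2 * h) * 6 <= m ^+ 2.
      rewrite /h.
      have -> : C * (2 * (m ^+ 2 / (12 * (C + 1)))) * 6 =
          m ^+ 2 * (C / (C + 1)).
        by field; rewrite gt_eqF // ltr_wpDl.
      by rewrite ger_pMr // ler_pdivrMr ?ltr_wpDl // mul1r lerDl.
    have := ler_wpM2r (rnorm_ge0 x) Ch.
    by move: D; rewrite mulrAC; lra.
  have an : rnorm (a ^+ n *: u) = r ^+ n * rnorm u.
    by rewrite rnormZ rnormX rnormC.
  have bn : rnorm (b ^+ n *: w) = r' ^+ n * rnorm w.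
    by rewrite rnormZ rnormX rnormC // ltW.
  have h1 := hj0 _ jj0 u; rewrite -/n -an in h1.
  have h2 : rnorm (iter n T u) <= rnorm x + rnorm (a ^+ n *: u).
    by rewrite -ux -{1}(subrK (a ^+ n *: u) (iter n T u)) rnormD.
  have h3 : rnorm (b ^+ n *: w) <=
      rnorm (iter n T u - iter n T w) + rnorm (a ^+ n *: u).
    have -> : b ^+ n *: w = (iter n T w - iter n T u) + a ^+ n *: u.
      have -> : a ^+ n *: u = iter n T u - x by rewrite -ux subKr.
      by rewrite addrA subrK /x subKr.
    by rewrite [in leRHS]rdistC rnormD.
  have h4 : rnorm x <= rnorm (iter n T w) + rnorm (b ^+ n *: w).
    exact: rnormB.
  (* [h1] and [h2] give |a^n u| <= |x| / 3. With [D] and [h3], |b^n w| <= |x| / 6 + |x| / 3 = |x| /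
     2, and [h4] bounds |x|. *)
  have h5 : rnorm (b ^+ n *: w) <= rnorm (iter n T w) by lra.
  apply: le_trans h5; rewrite bn.
  have -> : 4 * ((r + h) ^+ n * rnorm w) =
      (4 * ((r + h) / r') ^+ n) * (r' ^+ n * rnorm w).
    rewrite exprMn exprVn; field.
    by rewrite expf_neq0 // gt_eqF.
  by rewrite ler_piMl ?hj1 // mulr_ge0 ?rnorm_ge0 ?exprn_ge0 ?ltW.
have Qk k : Q (h *+ k).
  elim: k => [|k IH].
    exists 0%N => j _ w.
    by rewrite mulr0n expr0n expn_eq0 /= mul0r mulr0 rnorm_ge0.
  by rewrite mulrSr; apply: step => //; rewrite mulrn_wge0 // ltW.
have [k hk] : exists k, C < h *+ k.
  exists (Num.truncn (C / h)).+1; rewrite -mulr_natr mulrC -ltr_pdivrMr //.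
  exact: truncnS_gt.
have [j0 /(_ j0 (leqnn _) w0)] := Qk k.
have := rnorm_iter C0 Tb (2 ^ j0) w0.
have r0 : 0 < (h *+ k) ^+ (2 ^ j0) * rnorm w0.
  by rewrite mulr_gt0 // exprn_gt0 // (le_lt_trans C0).
have : C ^+ (2 ^ j0) * rnorm w0 <= (h *+ k) ^+ (2 ^ j0) * rnorm w0.
  rewrite ler_wpM2r ?rnorm_ge0 // lerXn2r // ?nnegrE ?ltW //.
  exact: le_lt_trans hk.
lra.
Qed.

(** * Cluster points of scalars, convergence and completeness *)

Lemma bounded_seq_cluster (R : realType) (u : nat -> R[i]) (B : R) :
  (forall n, rnorm (u n) <= B) ->
  exists l, forall e, 0 < e -> forall n0, exists2 n, (n0 <= n)%N &
    rnorm (u n - l) < e.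
Proof.
move=> uB.
pose f n : R * R := (complex.Re (u n), complex.Im (u n)).
have cK : compact (`[-B, B]%classic `*` `[-B, B]%classic : set (R * R)).
  by apply: compact_setX; exact: segment_compact.
have reB (z : R[i]) : `|complex.Re z| <= rnorm z.
  by rewrite -lecR -rnormE normc_ge_Re.
have imB (z : R[i]) : `|complex.Im z| <= rnorm z.
  have := reB (z * 'i%C); rewrite ReiNIm normrN rnormM.
  by rewrite {2}/rnorm normc_def /= expr0n expr1n add0r sqrtr1 mulr1.
have fK : (f @ \oo) (`[-B, B]%classic `*` `[-B, B]%classic).
  exists 0%N => // n _; split => /=; rewrite in_itv /= -ler_norml;
    exact: le_trans (uB n).
have [[p q] [_ pq]] := cK _ _ fK.
exists (p +i* q)%C => e e0 n0.
have A : (f @ \oo) (f @` [set n | (n0 <= n)%N]).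
  by exists n0 => // n /= nn; exists n.
have Bn : nbhs (p, q) (ball (p, q) (e / 2)).
  by apply: nbhsx_ballx; rewrite divr_gt0.
have [_ [[n nn <-] [/= n1 n2]]] := pq _ _ A Bn.
exists n => //.
have tri (z : R[i]) : rnorm z <= `|complex.Re z| + `|complex.Im z|.
  rewrite {1}[z]complexE (le_trans (rnormD _ _)) //.
  rewrite rnormM [rnorm 'i%C]/rnorm normc_def /=.
  rewrite expr0n expr1n add0r sqrtr1 mul1r.
  by rewrite /rnorm !normc_def /= expr0n /= !addr0 !sqrtr_sqr.
apply: (le_lt_trans (tri _)).
move: n1 n2; rewrite /f /ball /=.
rewrite [`|p - _|]distrC [`|q - _|]distrC.
case: (u n) => x y /=.
move=> h1 h2; lra.
Qed.

(** Formulations with a real [e], so that estimates stay in the totally ordered [R]; [rcvgP] and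
    [rcauchy_cauchy] link them to the filters of [complete_subset]. *)
Definition rcauchy (R : realType) (V : normedModType R[i]) (u : nat -> V) :=
  forall e, 0 < e -> exists n0, forall m n, (n0 <= m)%N -> (n0 <= n)%N ->
    rnorm (u m - u n) < e.

Definition rcvg (R : realType) (V : normedModType R[i]) (u : nat -> V) l :=
  forall e, 0 < e -> exists n0, forall n, (n0 <= n)%N -> rnorm (u n - l) < e.

Definition rcomplete (R : realType) (V : normedModType R[i]) :=
  forall u : nat -> V, rcauchy u -> exists l, rcvg u l.

Lemma gt0_complex (R : realType) (e : R[i]) :
  0 < e -> exists2 d : R, 0 < d & e = d%:C%C.
Proof.
move=> e0; have /complex_realP[d ed] : e \is Num.real by rewrite gtr0_real.
by exists d => //; rewrite ed ltcR in e0.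
Qed.

Lemma rcvgP (R : realType) (V : normedModType R[i]) (u : nat -> V) l :
  u @ \oo --> l <-> rcvg u l.
Proof.
split=> [/cvgrPdist_lt ul e e0|ul].
  have [|n0 _ h] := ul e%:C%C; first by rewrite ltcR.
  by exists n0 => n /h /=; rewrite distrC rnormE ltcR.
apply/cvgrPdist_lt => _ /gt0_complex[e e0 ->].
have [n0 h] := ul e e0; exists n0 => // n /= /h.
by rewrite distrC rnormE ltcR.
Qed.

Lemma rcauchy_cauchy (R : realType) (V : normedModType R[i]) (u : nat -> V) :
  rcauchy u -> cauchy (u @ \oo).
Proof.
move=> uc; apply: cauchy_exP => _ /gt0_complex[e e0 ->].
have [n0 h] := uc e e0; exists (u n0), n0 => // n /= nn.
by rewrite -ball_normE /= rnormE ltcR; exact: h.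
Qed.

Lemma rcvg_dist_le (R : realType) (V : normedModType R[i]) (u : nat -> V) l a
    (r : R) n0 : rcvg u l ->
  (forall n, (n0 <= n)%N -> rnorm (u n - a) <= r) -> rnorm (l - a) <= r.
Proof.
move=> ul ua; apply/ler_addgt0Pr => e e0; have [n1 h] := ul e e0.
apply: (le_trans (triangle (u (maxn n0 n1)) _ _)).
rewrite addrC lerD ?ua ?leq_maxl // rdistC ltW // h //.
exact: leq_maxr.
Qed.

Lemma exp_half_small (R : realType) (B e : R) : 0 <= B -> 0 < e ->
  exists n, B * 2^-1 ^+ n < e.
Proof.
move=> B0 e0; have B1 : 0 < B + 1 by rewrite ltr_wpDl.
have : `|2^-1 : R| < 1 by rewrite ger0_norm ?invr_ge0 // invf_lt1 ?ltr1n.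
move=> /cvg_expr/cvgrPdist_lt/(_ (e / (B + 1))) [|n _ /(_ n (leqnn n)) /=].
  exact: divr_gt0.
rewrite sub0r normrN ger0_norm ?exprn_ge0 ?invr_ge0 // => h; exists n.
move: h; rewrite ltr_pdivlMr // mulrDr mulr1 => h.
rewrite mulrC (le_lt_trans _ h) // lerDl exprn_ge0 // invr_ge0.
Qed.

Lemma geometric_cvg (R : realType) (V : normedModType R[i]) (u : nat -> V)
    (B : R) : rcomplete V -> 0 <= B ->
  (forall n, rnorm (u n.+1 - u n) <= B * 2^-1 ^+ n) ->
  exists2 l, rcvg u l & rnorm (l - u 0%N) <= 2 * B.
Proof.
move=> Vc B0 ub.
have g0 n : 0 <= 2^-1 ^+ n :> R by rewrite exprn_ge0 // invr_ge0.
(* The exact value of the geometric sum is what the induction on [k] preserves. *)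
have ubk n k : rnorm (u (n + k)%N - u n) <=
    2 * B * (2^-1 ^+ n - 2^-1 ^+ (n + k)).
  elim: k => [|k IH]; first by rewrite addn0 !subrr rnorm0 mulr0.
  apply: (le_trans (triangle (u (n + k)%N) _ _)).
  have := lerD (ub (n + k)%N) IH; rewrite addnS exprS.
  move=> h; apply: (le_trans h); lra.
have ubn n0 n : (n0 <= n)%N -> rnorm (u n - u n0) <= 2 * B * 2^-1 ^+ n0.
  move=> nn; rewrite -(subnKC nn) (le_trans (ubk _ _)) //.
  by rewrite ler_wpM2l ?mulr_ge0 // gerBl.
have [|l ul] := Vc u.
  move=> e e0; have [|n0 hn] := @exp_half_small _ (2 * (2 * B)) e _ e0.
    by rewrite !mulr_ge0.
  exists n0 => m n hm hnn; apply: (le_lt_trans (triangle (u n0) _ _)).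
  by rewrite [X in _ + X]rdistC; have := ubn _ _ hm; have := ubn _ _ hnn; lra.
exists l => //; apply: (rcvg_dist_le (n0 := 0) ul) => n n0.
by have := ubn _ _ n0; rewrite expr0 mulr1.
Qed.

(** * Baire category and the open mapping theorem *)

(** Otherwise every ball contains a smaller one avoiding a prescribed [E n]. Treating n = 0, 1, 2,
    ... in turn gives nested balls of halving radii, whose centres converge to a point outside every
    [E n]. *)
Lemma baire_dense_in_ball (R : realType) (V : normedModType R[i])
    (E : nat -> set V) : rcomplete V -> (forall y, exists n, E n y) ->
  exists n y0 r, 0 < r /\ forall y, rnorm (y - y0) < r ->
    forall e, 0 < e -> exists2 z, E n z & rnorm (z - y) < e.
Proof.
move=> Vc Ecov; apply: contrapT => hn.
(* The pairs are centre and radius. Positivity of the radius is a premise inside the existential so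
   that [choice] yields a total function; for a radius <= 0 any value will do. *)
have step (np : nat * (V * R)) : exists q : V * R, 0 < np.2.2 ->
    [/\ 0 < q.2, q.2 <= np.2.2 / 2, rnorm (q.1 - np.2.1) + q.2 <= np.2.2 &
        forall z, E np.1 z -> q.2 < rnorm (z - q.1)].
  case: np => n [y0 r] /=; have [r0|] := ltP 0 r; last by exists (y0, r).
  have [y [e [yr e0 hE]]] : exists y e, [/\ rnorm (y - y0) < r, 0 < e &
      forall z, E n z -> e <= rnorm (z - y)].
    apply: contrapT => h; apply: hn; exists n, y0, r; split=> // y yr e e0.
    apply: contrapT => h'; apply: h; exists y, e; split=> // z Ez.
    by rewrite leNgt; apply/negP => h''; apply: h'; exists z.
  (* The three bounds serve to avoid [E n], to halve the radius and to stay in the old ball. With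
     [e / 2] the whole closed ball avoids [E n], as is needed for a limit that may lie on its
     boundary. *)
  exists (y, Num.min (e / 2) (Num.min (r / 2) (r - rnorm (y - y0)))) => _ /=.
  split.
  - by rewrite !lt_min !divr_gt0 // subr_gt0.
  - by rewrite !ge_min lexx orbT.
  - by rewrite addrC -lerBrDr !ge_min lexx !orbT.
  - move=> z /hE ez; rewrite !gt_min; apply/orP; left; lra.
have [f fP] := choice step.
pose s := fix s n : V * R := if n is n'.+1 then f (n', s n') else (0, 1).
have s0 n : 0 < (s n).2.
  by elim: n => [|n IH] //=; have [] := fP (n, s n) IH.
have sS n := fP (n, s n) (s0 n).
have sg n : (s n).2 <= 2^-1 ^+ n.
  elim: n => [|n IH] //; have [_ h _ _] := sS n; rewrite exprS.
  by apply: (le_trans h); rewrite mulrC ler_wpM2l // invr_ge0.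
have [|||l ul _] := @geometric_cvg _ V (fun n => (s n).1) 1 => //.
  move=> n; rewrite mul1r; apply: le_trans (sg n).
  by have [h _ h' _] := sS n; move: h h' => /= h h'; lra.
have [n En] := Ecov l.
have [_ _ _ /(_ l En)] := sS n; rewrite ltNge => /negP; apply.
apply: (@rcvg_dist_le _ _ _ l (s n.+1).1 _ n.+1 ul) => m nm.
have : rnorm ((s m).1 - (s n.+1).1) + (s m).2 <= (s n.+1).2.
  rewrite -(subnKC nm); elim: (m - _)%N => [|k IH].
    by rewrite addn0 subrr rnorm0 add0r.
  rewrite addnS; have [_ _ /= h _] := sS (n.+1 + k)%N.
  have := triangle (s (n.+1 + k)%N).1 (s (n.+1 + k).+1).1 (s n.+1).1.
  by move: IH h => /=; lra.
by apply: le_trans; rewrite lerDl ltW.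
Qed.

(** By Baire the image of some ball is dense in a ball; after recentring and scaling, every z is
    approximated within |z| / 2 by some T x with |x| <= M |z|. Iterating on the residual builds the
    preimage of z as a series of norm at most 2M |z|. *)
Lemma bijective_bounded_below (R : realType) (V : normedModType R[i])
    (T : {linear V -> V}) (C : R) : rcomplete V ->
  (forall x, rnorm (T x) <= C * rnorm x) -> bijective T ->
  exists2 c, 0 < c & forall x, c * rnorm x <= rnorm (T x).
Proof.
move=> Vc Tb Tbij; have [S TS ST] := Tbij.
pose E n : set V := [set T x | x in [set x | rnorm x <= n%:R]].
have [y|n [y0 [r [r0 hr]]]] := @baire_dense_in_ball _ V E Vc.
  exists (Num.truncn (rnorm (S y))).+1, (S y) => //=.
  exact/ltW/truncnS_gt.
(* A vector z is rescaled to norm r / 2 and approximated with |x| <= 2n; scaling back gives 2n |z| /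
   (r / 2). *)
pose M := 4 * n%:R / r.
have M0 : 0 <= M by rewrite divr_ge0 // ?mulr_ge0 // ltW.
(* Subtracting approximants of [y0 + z] and [y0] moves the ball to the origin and doubles the bound
   [n]. *)
have small z e : rnorm z < r -> 0 < e ->
    exists2 x, rnorm x <= 2 * n%:R & rnorm (z - T x) < e.
  move=> zr e0; have e20 : 0 < e / 2 by rewrite divr_gt0.
  have [|_ [x1 /= x1n <-] h1] := hr (y0 + z) _ _ e20.
    by rewrite addrAC subrr add0r.
  have [|_ [x2 /= x2n <-] h2] := hr y0 _ _ e20; first by rewrite subrr rnorm0.
  exists (x1 - x2); first by have := rnormB x1 x2; lra.
  have -> : z - T (x1 - x2) = (T x2 - y0) - (T x1 - (y0 + z)).
    by rewrite linearB !opprB !addrA subrK [z + _]addrC.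
  by have := rnormB (T x2 - y0) (T x1 - (y0 + z)); lra.
have half z :
    exists x, rnorm x <= M * rnorm z /\ rnorm (z - T x) <= rnorm z / 2.
  have [->|z0] := eqVneq z 0.
    by exists 0; rewrite linear0 subrr !rnorm0 mulr0 mul0r.
  have zp : 0 < rnorm z by rewrite rnorm_gt0.
  pose t := r / (2 * rnorm z).
  have t0 : 0 < t by rewrite divr_gt0 // mulr_gt0.
  have tC0 : t%:C%C != 0 :> R[i] by rewrite gt_eqF // ltcR.
  have tn : rnorm (t%:C%C : R[i]) = t by rewrite rnormC // ltW.
  have [||x xn hx] := small (t%:C%C *: z) (t * (rnorm z / 2)).
  - rewrite rnormZ tn /t.
    have -> : r / (2 * rnorm z) * rnorm z = r / 2 by field; rewrite gt_eqF.
    lra.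
  - by rewrite mulr_gt0 // divr_gt0.
  exists ((t%:C%C)^-1 *: x).
  have E1 : t * rnorm ((t%:C%C)^-1 *: x) = rnorm x.
    by rewrite -{1}tn -rnormZ scalerA mulfV // scale1r.
  have E2 : t * rnorm (z - T ((t%:C%C)^-1 *: x)) = rnorm (t%:C%C *: z - T x).
    by rewrite -{1}tn -rnormZ scalerBr (linearZZ T) scalerA mulfV // scale1r.
  split; rewrite -(ler_pM2l t0).
    rewrite E1 (le_trans xn) // /t /M le_eqVlt; apply/orP; left; apply/eqP.
    by field; rewrite !gt_eqF.
  by rewrite E2 ltW.
have [g gP] := choice half.
clearbody M.
have key z : rnorm (S z) <= 2 * (M * rnorm z).
  (* Each term corrects the residual left by the previous ones, which halves at every step. *)
  pose s := fix s k : V := if k is k'.+1 then s k' + g (z - T (s k')) else 0.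
  have sz k : rnorm (z - T (s k)) <= rnorm z * 2^-1 ^+ k.
    elim: k => [|k IH]; first by rewrite linear0 subr0 expr0 mulr1.
    rewrite /= linearD opprD addrA; have [_ h] := gP (z - T (s k)).
    by rewrite (le_trans h) // exprSr mulrA ler_wpM2r.
  have [||l sl l0] := @geometric_cvg _ V s (M * rnorm z) Vc.
  - by rewrite mulr_ge0 ?rnorm_ge0.
  - move=> k; rewrite /= addrAC subrr add0r; have [h _] := gP (z - T (s k)).
    by rewrite (le_trans h) // -mulrA ler_wpM2l.
  suff <- : l = S z by rewrite -[l]subr0.
  apply: (can_inj TS); rewrite ST; apply/eqP; rewrite -subr_eq0 -rnorm_eq0.
  rewrite eq_le rnorm_ge0 andbT; apply/ler_addgt0Pr => e e0; rewrite add0r.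
  (* A positive divisor whatever the sign of [C], for the continuity argument that T l = z. *)
  have C1 : 0 < `|C| + 1 by rewrite ltr_wpDl.
  have e20 : 0 < e / 2 by rewrite divr_gt0.
  have [n1 h1] := sl (e / 2 / (`|C| + 1)) (divr_gt0 e20 C1).
  have [n2 h2] := exp_half_small (rnorm_ge0 z) e20.
  pose k := maxn n1 n2.
  have {}h1 := h1 k (leq_maxl _ _).
  have {}h2 : rnorm z * 2^-1 ^+ k < e / 2.
    apply: le_lt_trans h2; rewrite ler_wpM2l ?rnorm_ge0 // ler_wiXn2l //.
    + by rewrite invf_le1 ?ler1n.
    + exact: leq_maxr.
  have h3 : rnorm (T l - z) <= rnorm (T (l - s k)) + rnorm (z - T (s k)).
    by rewrite linearB [rnorm (z - _)]rdistC triangle.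
  have h4 := Tb (l - s k); rewrite rdistC in h4.
  have h5 : C * rnorm (s k - l) <= e / 2.
    apply: (@le_trans _ _ ((`|C| + 1) * rnorm (s k - l))).
      by rewrite ler_wpM2r ?rnorm_ge0 // (le_trans (ler_norm C)) // lerDl ler01.
    by rewrite mulrC -ler_pdivlMr // ltW.
  have := sz k; lra.
exists (2 * M + 1)^-1 => [|x]; first by rewrite invr_gt0 ltr_wpDl ?mulr_ge0.
rewrite ler_pdivrMl ?ltr_wpDl ?mulr_ge0 //.
have := key (T x); rewrite TS => h; apply: (le_trans h).
by rewrite mulrA ler_wpM2r ?rnorm_ge0 // lerDl.
Qed.

(** * Approximate eigenvalues *)

(** The scalar supplied by [resolvent_unbounded] depends on [m]. For m = 2^-k these scalars have
    modulus at most C + 1, and a cluster point of them serves for all [e] at once. *)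
Lemma spectrum_nonempty (R : realType) (V : normedModType R[i])
    (T : {linear V -> V}) (C : R) (w0 : V) : w0 != 0 ->
  (forall x, rnorm (T x) <= C * rnorm x) ->
  (forall (l : R[i]) x, exists v, T v - l *: v = x) ->
  exists l : R[i], forall e, 0 < e ->
    exists x, rnorm (T x - l *: x) < e * rnorm x.
Proof.
move=> w00 Tb Ts.
have g0 k : 0 < 2^-1 ^+ k :> R by rewrite exprn_gt0 // invr_gt0.
have /choice[f fP] (k : nat) : exists p : R[i] * V,
    rnorm (T p.2 - p.1 *: p.2) < 2^-1 ^+ k * rnorm p.2.
  by have [l [x lx]] := resolvent_unbounded w00 (g0 k) Tb Ts; exists (l, x).
have x0 k : 0 < rnorm (f k).2.
  by rewrite -(pmulr_rgt0 _ (g0 k)) (le_lt_trans _ (fP k)) // rnorm_ge0.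
have [|l hl] := @bounded_seq_cluster _ (fun k => (f k).1) (C + 1).
  move=> k; rewrite -(ler_pM2r (x0 k)) -rnormZ.
  have h1 := rnormB (T (f k).2) (T (f k).2 - (f k).1 *: (f k).2).
  rewrite subKr in h1.
  have h2 : 2^-1 ^+ k * rnorm (f k).2 <= rnorm (f k).2.
    by rewrite ler_piMl ?rnorm_ge0 // exprn_ile1 ?invr_ge0 // invf_le1 ?ler1n.
  by move: (Tb (f k).2) (fP k); lra.
exists l => e e0.
have e20 : 0 < e / 2 by rewrite divr_gt0.
have [n0 hn0] := exp_half_small (@ler01 R) e20; rewrite mul1r in hn0.
have [n nn hn] := hl _ e20 n0; exists (f n).2.
apply: (le_lt_trans (triangle ((f n).1 *: (f n).2) _ _)).
rewrite -scalerBl rnormZ.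
have h1 : rnorm ((f n).1 - l) * rnorm (f n).2 <= e / 2 * rnorm (f n).2.
  by rewrite ler_wpM2r ?rnorm_ge0 // ltW.
have h2 : 2^-1 ^+ n * rnorm (f n).2 <= e / 2 * rnorm (f n).2.
  rewrite ler_wpM2r ?rnorm_ge0 // (le_trans _ (ltW hn0)) //.
  by rewrite ler_wiXn2l // invf_le1 ?ler1n.
by move: (fP n); lra.
Qed.

(** * Topological divisors of zero and completeness of the algebra *)

(** The strict inequality excludes x = 0, so vectors chosen for e = 2^-k can be normalised into the
    required sequence. *)
Lemma zero_divisorP (R : realType) (A : normedModType R[i])
    (mul : {bilinear A -> A -> A}) (a : A) :
  left_topological_zero_divisors mul a <->
  forall e, 0 < e -> exists x, rnorm (mul a x) < e * rnorm x.
Proof.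
split=> [[x [x1 /rcvgP ax]] e e0|h].
  have [n0 /(_ n0 (leqnn n0))] := ax e e0; rewrite subr0 => h.
  by exists (x n0); rewrite [rnorm (x n0)]/rnorm x1 mulr1.
have g0 k : 0 < 2^-1 ^+ k :> R by rewrite exprn_gt0 // invr_gt0.
have /choice[x xP] (k : nat) := h _ (g0 k).
have x0 k : 0 < rnorm (x k).
  by rewrite -(pmulr_rgt0 _ (g0 k)) (le_lt_trans _ (xP k)) // rnorm_ge0.
have xn k : rnorm ((rnorm (x k))%:C%C^-1 : R[i]) = (rnorm (x k))^-1.
  by rewrite -fmorphV rnormC // invr_ge0 rnorm_ge0.
exists (fun k => (rnorm (x k))%:C%C^-1 *: x k); split=> [k|].
  by rewrite rnormE rnormZ xn mulVf ?gt_eqF.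
apply/rcvgP => e e0; have [n0 hn0] := exp_half_small (@ler01 R) e0.
rewrite mul1r in hn0; exists n0 => n nn.
rewrite subr0 linearZr_LR /= rnormZ xn.
have h1 : (rnorm (x n))^-1 * rnorm (mul a (x n)) < 2^-1 ^+ n.
  by rewrite mulrC ltr_pdivrMr.
apply: (lt_le_trans h1); apply: le_trans (ltW hn0).
by rewrite ler_wiXn2l // invf_le1 ?ler1n.
Qed.

Lemma not_zero_divisor_bound (R : realType) (A : normedModType R[i])
    (mul : {bilinear A -> A -> A}) (b : A) :
  ~ left_topological_zero_divisors mul b ->
  exists2 c, 0 < c & forall x, c * rnorm x <= rnorm (mul b x).
Proof.
move=> nb; apply: contrapT => h; apply: nb; apply/zero_divisorP => e e0.
apply: contrapT => h'; apply: h; exists e => // x.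
by rewrite leNgt; apply/negP => h''; apply: h'; exists x.
Qed.

Lemma submul_rnorm (R : realType) (A : normedModType R[i])
    (mul : {bilinear A -> A -> A}) : submultiplicative mul ->
  forall x y, rnorm (mul x y) <= rnorm x * rnorm y.
Proof. by move=> sm x y; rewrite -lecR rmorphM /= -!rnormE. Qed.

(* [l] is a spectral value of L_b^-1 L_c. *)
Lemma zero_divisor_mod_line (R : realType) (A : normedModType R[i])
    (mul : {bilinear A -> A -> A}) (b c : A) :
  submultiplicative mul -> left_linear_division mul ->
  ~ left_topological_zero_divisors mul b ->
  exists l : R[i], left_topological_zero_divisors mul (c - l *: b).
Proof.
move=> /submul_rnorm sm [[w0 w00] bij] nb.
have Dg0 : left_topological_zero_divisors mul 0.
  apply/zero_divisorP => e e0; exists w0.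
  by rewrite linear0l rnorm0 mulr_gt0 // rnorm_gt0.
have b0 : b != 0 by apply: contra_notN nb => /eqP->.
(* If c - l b = 0 for some l, the claim holds because 0 is in D_g. Otherwise each T - l = L_b^-1
   L_(c - l b) is surjective, as [spectrum_nonempty] requires. *)
have [[l /eqP cl]|ncl] := pselect (exists l : R[i], c - l *: b == 0).
  by exists l; rewrite cl.
have [S bS Sb] := bij b b0.
pose T x := S (mul c x).
have bT x : mul b (T x) = mul c x by rewrite /T Sb.
have Tlin : linear T.
  by move=> k u v; apply: (can_inj bS); rewrite linearPr /= !bT linearPr.
pose TL : {linear A -> A} :=
  HB.pack T (GRing.isLinear.Build _ _ _ _ T Tlin).
have [d d0 hd] := not_zero_divisor_bound nb.
have [|l x|l hl] := @spectrum_nonempty _ A TL (rnorm c / d) w0 w00.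
- move=> x; rewrite mulrAC ler_pdivlMr // mulrC (le_trans (hd _)) //.
  by rewrite /= bT sm.
- have cl0 : c - l *: b != 0 by apply: contra_notN ncl => cl; exists l.
  have [S' _ S'b] := bij _ cl0.
  exists (S' (mul b x)); apply: (can_inj bS).
  rewrite linearBr linearZr_LR /= bT -[RHS]S'b.
  by rewrite linearBl linearZl_LR.
exists l; apply/zero_divisorP => e e0.
have bp : 0 < rnorm b by rewrite rnorm_gt0.
have [x hx] := hl (e / rnorm b) (divr_gt0 e0 bp); exists x.
have -> : mul (c - l *: b) x = mul b (TL x - l *: x).
  by rewrite linearBr linearZr_LR /= bT linearBl linearZl_LR.
apply: (le_lt_trans (sm _ _)).
by move: hx; rewrite mulrAC ltr_pdivlMr // mulrC.
Qed.

(** On a vector x that c - l b nearly annihilates, c x and l (b x) nearly agree, and their norms are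
    compared. The bound makes the coefficients of a Cauchy sequence modulo D_g cluster. *)
Lemma zero_divisor_coef_bound (R : realType) (A : normedModType R[i])
    (mul : {bilinear A -> A -> A}) (b c : A) (l : R[i]) (d : R) :
  submultiplicative mul ->
  (forall x, d * rnorm x <= rnorm (mul b x)) ->
  left_topological_zero_divisors mul (c - l *: b) -> d * rnorm l <= rnorm c.
Proof.
move=> /submul_rnorm sm hd /zero_divisorP Dg; apply/ler_addgt0Pr => e e0.
have [x hx] := Dg e e0.
have xp : 0 < rnorm x.
  by rewrite -(pmulr_rgt0 _ e0) (le_lt_trans _ hx) // rnorm_ge0.
rewrite -(ler_pM2r xp).
have h1 : d * rnorm x * rnorm l <= rnorm (mul (l *: b) x).
  by rewrite [mul _ _]linearZl_LR rnormZ mulrC ler_wpM2l ?rnorm_ge0.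
have h2 := rnormB (mul c x) (mul (c - l *: b) x).
rewrite {1}linearBl subKr in h2.
have h3 := sm c x.
by move: hx; lra.
Qed.

Lemma complete_of_zero_divisors (R : realType) (A : normedModType R[i])
    (mul : {bilinear A -> A -> A}) :
  submultiplicative mul -> left_linear_division mul ->
  complete_subset (left_topological_zero_divisors mul) -> rcomplete A.
Proof.
move=> sm ld Dgc u uc.
have [Dall|] := pselect (forall b, left_topological_zero_divisors mul b).
  have [l _ /rcvgP ul] := Dgc u (fun n => Dall (u n)) (rcauchy_cauchy uc).
  by exists l.
move=> /existsNP[b nb]; have [d d0 hd] := not_zero_divisor_bound nb.
have /choice[a aP] n := zero_divisor_mod_line (u n) sm ld nb.
have [n0 hn0] := uc 1 ltr01.
(* The shift by [n0] puts all terms within 1 of [u n0], which bounds |u n| and hence the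
   coefficients. *)
have [|l hl] := @bounded_seq_cluster _ (fun n => a (n0 + n)%N)
    ((rnorm (u n0) + 1) / d).
  move=> n; rewrite ler_pdivlMr // mulrC.
  apply: (le_trans (zero_divisor_coef_bound sm hd (aP _))).
  have := rnormD (u n0) (u (n0 + n)%N - u n0); rewrite addrC subrK.
  by have := hn0 (n0 + n)%N n0 (leq_addr _ _) (leqnn _); lra.
(* [k <= f k] takes the place of monotonicity: the Cauchy estimates only ask for large indices. *)
have /choice[f fP] (k : nat) : exists n, (k <= n)%N /\
    rnorm (a n - l) * rnorm b <= 2^-1 ^+ k.
  have [|n kn hn] := hl (2^-1 ^+ k / (rnorm b + 1)) _ k.
    by rewrite divr_gt0 ?exprn_gt0 ?invr_gt0 // ltr_wpDl ?rnorm_ge0.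
  exists (n0 + n)%N; split; first by rewrite (leq_trans kn) // leq_addl.
  move: hn; rewrite ltr_pdivlMr ?ltr_wpDl ?rnorm_ge0 // => hn.
  apply: le_trans (ltW hn).
  by rewrite ler_wpM2l ?rnorm_ge0 // lerDl.
have gm n1 k : (n1 <= k)%N -> 2^-1 ^+ k <= 2^-1 ^+ n1 :> R.
  by move=> nk; rewrite ler_wiXn2l // invf_le1 ?ler1n.
pose v k := u (f k) - a (f k) *: b.
have vc : rcauchy v.
  move=> e e0; have e30 : 0 < e / 3 by rewrite divr_gt0.
  have [n1 h1] := uc _ e30; have [n2 h2] := exp_half_small (@ler01 R) e30.
  rewrite mul1r in h2.
  exists (maxn n1 n2) => i j; rewrite !geq_max => /andP[i1 i2] /andP[j1 j2].
  have [fi ai] := fP i; have [fj aj] := fP j.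
  have -> : v i - v j =
      (u (f i) - u (f j)) - ((a (f i) - l) *: b - (a (f j) - l) *: b).
    rewrite !scalerBl [- (a (f j) *: b - _)]opprB addrA subrK.
    by rewrite /v !opprD !opprK addrACA.
  have := rnormB (u (f i) - u (f j)) ((a (f i) - l) *: b - (a (f j) - l) *: b).
  have := rnormB ((a (f i) - l) *: b) ((a (f j) - l) *: b).
  rewrite !rnormZ.
  have := h1 _ _ (leq_trans i1 fi) (leq_trans j1 fj).
  by have := gm _ _ i2; have := gm _ _ j2; lra.
have [w _ /rcvgP vw] := Dgc v (fun k => aP (f k)) (rcauchy_cauchy vc).
exists (w + l *: b) => e e0; have e30 : 0 < e / 3 by rewrite divr_gt0.
have [n1 h1] := uc _ e30; have [n2 h2] := exp_half_small (@ler01 R) e30.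
rewrite mul1r in h2; have [n3 h3] := vw _ e30.
pose k := maxn n1 (maxn n2 n3).
have k1 : (n1 <= k)%N by rewrite leq_maxl.
have k2 : (n2 <= k)%N by rewrite /k !leq_max leqnn orbT.
have k3 : (n3 <= k)%N by rewrite /k !leq_max leqnn !orbT.
(* A single [k] suffices: u n is close to u (f k) by the Cauchy property, and u (f k) = v k + a (f
   k) b is close to w + l b. *)
exists n1 => n nn; have [fk ak] := fP k.
apply: (le_lt_trans (triangle (u (f k)) _ _)).
have -> : u (f k) - (w + l *: b) = (v k - w) + (a (f k) - l) *: b.
  by rewrite /v scalerBl [_ - w]addrAC addrA subrK opprD addrA.
have := rnormD (v k - w) ((a (f k) - l) *: b); rewrite rnormZ.
have := h1 _ _ nn (leq_trans k1 fk).
by have := h3 _ k3; have := gm _ _ k2; lra.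
Qed.

Lemma zero_divisor_eq0 (R : realType) (A : normedModType R[i])
    (mul : {bilinear A -> A -> A}) (a : A) :
  submultiplicative mul -> left_linear_division mul -> rcomplete A ->
  left_topological_zero_divisors mul a -> a = 0.
Proof.
move=> /submul_rnorm sm [_ bij] Ac /zero_divisorP Dg; apply/eqP.
apply: contrapT => /negP/bij ba.
have [c c0 hc] := @bijective_bounded_below _ A (mul a) _ Ac (sm a) ba.
by have [x] := Dg c c0; rewrite ltNge hc.
Qed.

(** * One-dimensional division algebras *)

(** Here b b = k b, with k nonzero because L_b is injective; e = k^-1 b is then idempotent, and the
    coordinate along e is multiplicative. *)
Lemma line_algebra_isomorphic (K : fieldType) (A : lmodType K)
    (mul : {bilinear A -> A -> A}) (b : A) :
  left_linear_division mul -> b != 0 -> (forall c, exists l : K, c = l *: b) ->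
  algebra_isomorphic (A := A) (B := K^o) mul (fun z w : K => z * w).
Proof.
move=> [_ bij] b0 span.
have [k bb] := span (mul b b).
have k0 : k != 0.
  have [S bS _] := bij b b0; apply: contra_neq b0 => k0.
  by apply: (can_inj bS); rewrite bb k0 scale0r linear0r.
pose e := k^-1 *: b.
have e0 : e != 0 by rewrite scaler_eq0 invr_eq0 negb_or k0.
have ee : mul e e = e.
  rewrite linearZl_LR linearZr_LR /= bb [k^-1 *: (k *: b)]scalerA.
  by rewrite mulVf // scale1r.
have /choice[f fP] c : exists l : K, c = l *: e.
  by have [l ->] := span c; exists (l * k); rewrite scalerA mulfK.
have inj (x y : K) : x *: e = y *: e -> x = y.
  move/eqP; rewrite -subr_eq0 -scalerBl scaler_eq0 (negPf e0) orbF subr_eq0.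
  by move/eqP.
have flin : linear (f : A -> K^o).
  move=> a u v; apply: inj; rewrite -fP scalerDl -fP {1}[u]fP.
  by rewrite scalerA.
pose fL : {linear A -> K^o} :=
  HB.pack (f : A -> K^o)
    (GRing.isLinear.Build _ _ _ _ (f : A -> K^o) flin).
exists fL; split.
  exists (fun z => z *: e) => [x|z] /=; first by rewrite -fP.
  by apply: inj; rewrite -fP.
move=> x y; apply: inj; rewrite -[LHS]fP {1}[x]fP {1}[y]fP.
by rewrite linearZl_LR linearZr_LR /= ee scalerA.
Qed.

Theorem mainTheorem2 (R : realType) (A : normedModType R[i])
    (mul : {bilinear A -> A -> A})
    (mul_normed : submultiplicative mul)
    (mul_division : left_linear_division mul)
    (Dg_complete : complete_subset (left_topological_zero_divisors mul)) :
  algebra_isomorphic (A := A) (B := (R[i])^o) mul (fun z w : R[i] => z * w).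
Proof.
have Ac := complete_of_zero_divisors mul_normed mul_division Dg_complete.
have [[b b0] _] := mul_division.
have nb : ~ left_topological_zero_divisors mul b.
  by move=> /(zero_divisor_eq0 mul_normed mul_division Ac) /eqP; apply/negP.
apply: line_algebra_isomorphic b0 _ => // c.
have [l /(zero_divisor_eq0 mul_normed mul_division Ac) cl] :=
  zero_divisor_mod_line c mul_normed mul_division nb.
by exists l; apply/eqP; rewrite -subr_eq0 cl.
Qed.
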